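(* Let $\Gamma_1=\{\lambda_1,\lambda_2,\ldots,\lambda_n\}$, with $\lambda_1>|\lambda_i|$ for $i=2,\ldots,n$, be the spectrum of a diagonalizable nonnegative $n\times n$ matrix $A\in\mathcal{CS}_{\lambda_1}$ whose last column is positive. Let $\Gamma_2=\{\mu_1,\mu_2,\ldots,\mu_m\}$, with $\mu_1>|\mu_i|$ for $i=2,\ldots,m$, be the spectrum of a diagonalizable nonnegative $m\times m$ matrix $B\in\mathcal{CS}_{\mu_1}$ whose last column is positive. Then the list $$\Gamma=\{\lambda_1+\mu_1,\lambda_2,\ldots,\lambda_n,\mu_2,\ldots,\mu_m\}$$ is universally realizable.
   Context: Lists are multisets of complex numbers (repetitions allowed). $\mathcal{CS}_\alpha$ denotes the set of all square matrices each of whose rows sums to the constant $\alpha$. Nonnegative and positive are meant entrywise; diagonalizable means diagonalizable over $\mathbb{C}$. A Jordan canonical form allowed by a list $\Gamma$ of $N$ complex numbers is a Jordan matrix with spectrum $\Gamma$ (with algebraic multiplicity) that is the Jordan canonical form of some real matrix (i.e. the blocks for non-real eigenvalues occur in conjugate pairs of equal sizes). $\Gamma$ is universally realizable if for every Jordan canonical form $\mathbf{J}$ allowed by $\Gamma$ there is an entrywise nonnegative $N\times N$ matrix with Jordan canonical form $\mathbf{J}$ (up to permutation of blocks). *)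

(* Defs.v *)
From HB Require Import structures.
From mathcomp Require Import all_boot all_order all_algebra.
From mathcomp Require Import complex reals.
Set Implicit Arguments.
Unset Strict Implicit.
Unset Printing Implicit Defensive.
Import Order.TTheory GRing.Theory Num.Theory.
Local Open Scope ring_scope.
Local Open Scope complex_scope.

Definition nonneg_mx (R : realType) n (A : 'M[R]_n) : Prop :=
  forall i j, 0 <= A i j.

(* The class CS_a of the matrices whose rows all sum to a. *)
Definition const_row_sum (R : realType) n (A : 'M[R]_n) (a : R) : Prop :=
  forall i, \sum_j A i j = a.

Definition complex_mx (R : realType) n (A : 'M[R]_n) : 'M[R[i]]_n :=
  map_mx (real_complex R) A.

(* The list s, as a multiset, consists of the eigenvalues of A counted with
   algebraic multiplicity. *)
Definition has_spectrum (R : realType) n (A : 'M[R[i]]_n) (s : seq R[i]) : Prop :=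
  char_poly A = \prod_(z <- s) ('X - z%:P).

Definition jordan_block (R : realType) n (a : R[i]) : 'M[R[i]]_n :=
  \matrix_(i, j) (if i == j then a else (i.+1 == j :> nat)%:R).

(* The cast only identifies the sum of the block sizes with n. *)
Definition is_jordan_mx (R : realType) n (J : 'M[R[i]]_n) : Prop :=
  exists (k : nat) (p : 'I_k -> nat) (a : 'I_k -> R[i])
         (e : (\sum_(i < k) p i)%N = n),
    (forall i, (0 < p i)%N) /\
    J = castmx (e, e) (\mxdiag_(i < k) jordan_block (p i) (a i)).

(* A Jordan canonical form is unique only up to the order of its blocks: J is
   any one of the Jordan matrices similar to M over the complex numbers. *)
Definition has_jordan_form (R : realType) n (M : 'M[R]_n) (J : 'M[R[i]]_n) : Prop :=
  is_jordan_mx J /\ complex_mx M ~_{in unitmx} J.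

Definition allowed_jordan_form (R : realType) (s : seq R[i])
    (J : 'M[R[i]]_(size s)) : Prop :=
  has_spectrum J s /\ exists M : 'M[R]_(size s), has_jordan_form M J.

Definition universally_realizable (R : realType) (s : seq R[i]) : Prop :=
  forall J : 'M[R[i]]_(size s), allowed_jordan_form J ->
  exists M : 'M[R]_(size s), nonneg_mx M /\ has_jordan_form M J.

(* Main.v *)
Require Import Defs.
From mathcomp Require Import all_boot all_order all_algebra.
From mathcomp Require Import complex reals.
From mathcomp Require Import perm separable polyorder zify.
Import Order.TTheory GRing.Theory Num.Theory.
Local Open Scope ring_scope.
Local Open Scope complex_scope.

(** A matrix with constant row sums [a] has the all-ones vector [e] as an
    eigenvector for [a], so it induces a map on the quotient by [e], and it is
    determined by [a], that quotient map and one row. The quotient of [A] is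
    diagonalizable with spectrum [lambda], that of [B] is diagonalizable with
    spectrum [mu]. The two matrices can be glued along their last index into a
    nonnegative matrix with constant row sums [lambda1 + mu1], with positive
    last column, and whose quotient is the direct sum of those of [A] and [B].
    Adding to it the product of [e] and a small row vector of sum zero changes
    neither the row sums nor the quotient, and moves some of the last column to
    the others: the result is an entrywise positive matrix [C]. Since
    [lambda1 + mu1] exceeds the moduli of the other eigenvalues, it is not an
    eigenvalue of the quotient, so [C] is diagonalizable and its spectrum is the
    required list.

    It remains to see that the spectrum of a diagonalizable positive matrix [C]
    is universally realizable ([universally_realizable_of_positive]). An allowed
    Jordan form is that of a real matrix [K] with the characteristic polynomial
    of [C]. Its actual blocks do not matter, because [C] is a limit of real
    matrices similar to [K]: any matrix similar to [K] and close enough to [C]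
    is positive and has the Jordan form of [K].

    For this limit, [sim_limit_diagonalizable] shows that the real similarity
    class of [K] accumulates at a real matrix [D] that is diagonalizable over
    the complex numbers and has the characteristic polynomial of [K]. If [K] is
    not diagonalizable, it has a proper nonzero invariant subspace
    ([diagonalizable_or_stable]), hence is similar to a block triangular matrix;
    conjugation by a block scaling makes the off-diagonal block arbitrarily
    small, and induction treats the diagonal blocks. Finally [C] and [D] are
    diagonalizable with the same characteristic polynomial, hence similar over
    the complex numbers, hence over the reals ([sim_descent]), and the real
    change of basis carries the approximations of [D] to approximations of
    [C]. *)

(** * Similarity and diagonalizability over a field *)

Lemma char_poly_sim {F : fieldType} n (P A B : 'M[F]_n) :
  P \in unitmx -> P *m A = B *m P -> char_poly A = char_poly B.
Proof.
move=> uP PAB; have Pc_neq0 : \det (map_mx polyC P) != 0.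
  by rewrite det_map_mx /= polyC_eq0 -unitfE -unitmxE.
apply: (mulfI Pc_neq0); rewrite /char_poly -det_mulmx [RHS]mulrC -det_mulmx.
by rewrite mulmxBr mulmxBl -!map_mxM PAB scalar_mxC.
Qed.

Lemma char_poly_lblock {F : fieldType} n1 n2 (A : 'M[F]_n1) (X : 'M_(n2, n1))
  (B : 'M_n2) : char_poly (block_mx A 0 X B) = char_poly A * char_poly B.
Proof.
rewrite /char_poly /char_poly_mx map_block_mx scalar_mx_block opp_block_mx.
by rewrite add_block_mx map_mx0 oppr0 addr0 det_lblock.
Qed.

Lemma diagonalizable_block_diag {F : fieldType} n1 n2 (A : 'M[F]_n1)
    (B : 'M_n2) :
  diagonalizable A -> diagonalizable B -> diagonalizable (block_mx A 0 0 B).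
Proof.
move=> [P uP /diagonalizable_forPex[c /(simmxP uP) Pc]].
move=> [Q uQ /diagonalizable_forPex[d /(simmxP uQ) Qd]].
have uPQ : block_mx P 0 0 Q \in unitmx by rewrite block_diag_mx_unit uP.
exists (block_mx P 0 0 Q) => //; apply/diagonalizable_forPex.
exists (row_mx c d); apply/simmxP => //.
by rewrite diag_mx_row !mulmx_block !(mulmx0, mul0mx, addr0, add0r) Pc Qd.
Qed.

(** The minimal polynomial of a restriction divides that of the whole matrix. *)
Lemma diagonalizable_restrict {F : fieldType} n k (V : 'M[F]_(k, n))
    (A : 'M_n) (A' : 'M_k) :
  row_free V -> V *m A = A' *m V -> diagonalizable A -> diagonalizable A'.
Proof.
move=> freeV VA; have <- : conjmx V A = A'.
  by rewrite /conjmx VA mulmxKp.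
have stV : stablemx V A by rewrite VA submxMl.
case: n k => [|n] [|k] in V A A' freeV VA stV *.
- by rewrite [conjmx V A]thinmx0 => _; exact: diagonalizable0.
- by move: freeV; rewrite thinmx0 /row_free mxrank0.
- by rewrite [conjmx V A]thinmx0 => _; exact: diagonalizable0.
move=> /diagonalizableP[rs urs dvd_rs]; apply/diagonalizableP; exists rs => //.
exact: dvdp_trans (mxminpoly_conj freeV stV) dvd_rs.
Qed.

(** Here [A'] is the restriction of [A] to an invariant subspace modulo which [A]
    acts as the scalar [a]. If [p] is a product of distinct linear factors other
    than ['X - a%:P] and annihilates [A'], then [p * ('X - a%:P)] annihilates
    [A]. *)
Lemma diagonalizable_extend {F : fieldType} n k (V : 'M[F]_(k, n))
    (A : 'M_n) (A' : 'M_k) a :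
  V *m A = A' *m V -> (A - a%:M <= V)%MS ->
  ~~ root (char_poly A') a -> diagonalizable A' -> diagonalizable A.
Proof.
move=> VA /submxP[Z AZ] aA'.
case: n k => [|n] [|k] in V A A' VA Z AZ aA' *.
- by rewrite [A]thinmx0 => _; exact: diagonalizable0.
- by rewrite [A]thinmx0 => _; exact: diagonalizable0.
- move=> _; have -> : A = a%:M.
    by apply/eqP; rewrite -subr_eq0 AZ [V]flatmx0 mulmx0.
  exact: diagonalizable_scalar.
move=> /diagonalizableP[rs urs dvd_rs]; apply/diagonalizableP.
exists (a :: rem a rs); first by rewrite /= mem_rem_uniqF ?rem_uniq.
set p := \prod_(x <- rem a rs) ('X - x%:P).
(* Coprimality with the minimal polynomial of A' lets the factor X - a go. *)
have pA' : horner_mx A' p = 0.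
  apply/mxminpoly_minP; case: (boolP (a \in rs)) => [ars | /rem_id E];
    last by rewrite /p E.
  have := dvd_rs; rewrite (big_rem _ ars) /= Gauss_dvdpr // coprimep_XsubC.
  by rewrite root_mxminpoly.
have Vp : V *m horner_mx A p = 0.
  have : V *m horner_mx A p = horner_mx A' p *m V.
    elim/poly_ind: (p) => [|q c IH]; first by rewrite !rmorph0 mulmx0 mul0mx.
    rewrite !rmorphD !rmorphM /= !horner_mx_X !horner_mx_C mulmxDr mulmxDl.
    by rewrite -scalar_mxC mulmxA IH -!mulmxA VA.
  by rewrite pA' mul0mx.
apply/mxminpoly_minP; rewrite big_cons rmorphM rmorphB /= horner_mx_X.
by rewrite horner_mx_C AZ -mulmxE -mulmxA Vp mulmx0.
Qed.

(** The diagonal forms have the same entries up to a permutation, by unique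
    factorization of the characteristic polynomial. *)
Lemma diagonalizable_char_poly_sim {F : fieldType} n (A B : 'M[F]_n) :
  diagonalizable A -> diagonalizable B -> char_poly A = char_poly B ->
  exists2 P, P \in unitmx & P *m A = B *m P.
Proof.
move=> [P uP /diagonalizable_forPex[c /(simmxP uP) Pc]].
move=> [Q uQ /diagonalizable_forPex[d /(simmxP uQ) Qd]].
rewrite (char_poly_sim _ _ _ _ uP Pc) (char_poly_sim _ _ _ _ uQ Qd).
rewrite !char_poly_trig ?diag_mx_is_trig //.
have diagE (e : 'rV[F]_n) : \prod_(i < n) ('X - (diag_mx e i i)%:P) =
    \prod_(x <- [tuple e 0 i | i < n]) ('X - x%:P).
  by rewrite big_map big_enum; apply: eq_bigr => i _; rewrite mxE eqxx.
rewrite !diagE => /prod_XsubC_eq /tuple_permP[s Es].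
have {}Es i : c 0 i = d 0 (s i).
  have := congr1 (fun l => nth 0 l i) Es; rewrite -!tnth_nth !tnth_mktuple //.
have sE : perm_mx s *m diag_mx d = diag_mx c *m perm_mx s.
  apply/matrixP => i j; rewrite -row_permE mul_diag_mx !mxE Es.
  by case: eqP => [->|]; rewrite ?mulr1 ?mulr0.
exists (invmx Q *m (invmx (perm_mx s) *m P)).
  by rewrite !unitmx_mul !unitmx_inv uQ uP unitmx_perm.
have us := unitmx_perm F s.
rewrite -!mulmxA Pc (mulmxA _ (diag_mx c)).
have -> : invmx (perm_mx s) *m diag_mx c = diag_mx d *m invmx (perm_mx s).
  apply: (can_inj (mulKmx us)); rewrite mulKVmx // mulmxA sE.
  by rewrite -mulmxA mulmxV ?mulmx1.
rewrite !mulmxA; congr (_ *m _ *m _).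
apply: (can_inj (mulKmx uQ)); rewrite mulKVmx // mulmxA Qd.
by rewrite mulmxK.
Qed.

(** * Complex similarity of real matrices is real similarity *)

(** The real and imaginary parts [X] and [Y] of a complex intertwiner are real
    intertwiners, and so is [X + k *: Y] for every real [k]. The polynomial
    [det (X + 'X *: Y)] does not vanish at the imaginary unit, so it is nonzero
    and some natural number [k] is not a root. *)
Lemma sim_descent {R : realType} n (A B : 'M[R]_n) (S : 'M[R[i]]_n) :
    S \in unitmx -> S *m complex_mx A = complex_mx B *m S ->
  exists2 P, P \in unitmx & P *m A = B *m P.
Proof.
move=> uS SAB.
have part (f : {additive R[i] -> R}) : (forall z x, f (z * x%:C) = f z * x) ->
    map_mx f S *m A = B *m map_mx f S.
  move=> fM; apply/matrixP => i j.
  move/matrixP/(_ i j)/(congr1 f): SAB; rewrite !mxE !raddf_sum.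
  under eq_bigr => k _ do rewrite [complex_mx A k j]mxE fM.
  under [in RHS]eq_bigr => k _ do rewrite [complex_mx B i k]mxE mulrC fM mulrC.
  move=> E; under eq_bigr => k _ do rewrite mxE.
  by under [RHS]eq_bigr => k _ do rewrite mxE.
pose X := map_mx (@complex.Re R) S; pose Y := map_mx (@complex.Im R) S.
have XAB : X *m A = B *m X.
  by apply: (part (@complex.Re R)) => -[a b] x /=; rewrite mulr0 subr0.
have YAB : Y *m A = B *m Y.
  by apply: (part (@complex.Im R)) => -[a b] x /=; rewrite mulr0 add0r.
pose p := \det (map_mx polyC X + 'X *: map_mx polyC Y).
have p_neq0 : p != 0.
  apply: contraTneq uS => p0; rewrite unitmxE unitfE negbK.
  have : (map_poly (real_complex R) p).['i%C] = 0 by rewrite p0 rmorph0 horner0.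
  rewrite /p -det_map_mx -[_.['i%C]]/(horner_eval 'i%C _) -det_map_mx => <-.
  apply/eqP; congr (\det _); apply/matrixP => i j; rewrite !mxE.
  rewrite rmorphD rmorphM /= !map_polyC map_polyX /= /horner_eval !hornerE.
  exact: complexE.
have [k pk] : exists k : nat, ~~ root p k%:R.
  pose rs := [seq k%:R : R | k <- iota 0 (size p)].
  have [/allPn[_ /mapP[k _ ->] pk] | rs_p] := boolP (~~ all (root p) rs).
    by exists k.
  have urs : uniq rs
    by rewrite map_inj_uniq ?iota_uniq //; exact: mulrIn (oner_neq0 _).
  have := max_poly_roots p_neq0 (negbNE rs_p) urs.
  by rewrite size_map size_iota ltnn.
exists (X + k%:R *: Y); last first.
  by rewrite mulmxDl mulmxDr -scalemxAl -scalemxAr XAB YAB.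
rewrite unitmxE unitfE; congr (~~ (_ == 0)) : pk.
rewrite -/(horner_eval _ p) -det_map_mx; congr (\det _).
by apply/matrixP => i j; rewrite !mxE /= /horner_eval !hornerE.
Qed.

(** * The closure of a similarity class *)

(** [D] lies in the closure of the real similarity class of [K]. The similar
    matrix [L] is described by an intertwining equation rather than as
    [P *m K *m invmx P], which keeps inverses of block matrices out of the
    proofs. *)
Definition sim_limit {R : realType} {n} (K D : 'M[R]_n) :=
  forall e : R, 0 < e -> exists P L, [/\ P \in unitmx, P *m K = L *m P
    & forall i j, `|L i j - D i j| < e].

Lemma sim_limit_refl {R : realType} n (K : 'M[R]_n) : sim_limit K K.
Proof.
move=> e e_gt0; exists 1%:M, K; rewrite unitmx1 mul1mx mulmx1.
by split=> // i j; rewrite subrr normr0.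
Qed.

Lemma sim_limit_siml {R : realType} n (P K K' D : 'M[R]_n) :
  P \in unitmx -> P *m K = K' *m P -> sim_limit K' D -> sim_limit K D.
Proof.
move=> uP PK KD e /KD[Q [L [uQ QK' LD]]]; exists (Q *m P), L.
by rewrite unitmx_mul uQ -mulmxA PK !mulmxA QK'.
Qed.

Lemma norm_mulmx_entry {R : realType} n (S E T : 'M[R]_n) (e : R) i j :
    (forall k l, `|E k l| <= e) ->
  `|(S *m E *m T) i j| <=
     (\sum_i \sum_k `|S i k|) * e * (\sum_l \sum_j `|T l j|).
Proof.
move=> Ee; have e_ge0 : 0 <= e := le_trans (normr_ge0 _) (Ee i j).
have S_ge0 k l : 0 <= `|S k l| by [].
rewrite mxE (le_trans (ler_norm_sum _ _ _)) // mulr_sumr ler_sum // => l _.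
rewrite normrM; apply: ler_pM => //; last first.
  by rewrite (bigD1 j) //= lerDl sumr_ge0.
rewrite mxE (le_trans (ler_norm_sum _ _ _)) //.
apply: (@le_trans _ _ ((\sum_k `|S i k|) * e)).
  by rewrite mulr_suml ler_sum // => k _; rewrite normrM ler_wpM2l.
rewrite ler_wpM2r // [leRHS](bigD1 i) //= lerDl sumr_ge0 // => k _.
exact: sumr_ge0.
Qed.

Lemma sim_limit_simr {R : realType} n (P K C D : 'M[R]_n) :
  P \in unitmx -> P *m C = D *m P -> sim_limit K D -> sim_limit K C.
Proof.
move=> uP PC KD e e_gt0.
set a := \sum_i \sum_k `|invmx P i k|; set b := \sum_i \sum_k `|P i k|.
have a_ge0 : 0 <= a by do 2 (apply: sumr_ge0 => ? _).
have b_ge0 : 0 <= b by do 2 (apply: sumr_ge0 => ? _).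
have ab_gt0 : 0 < a * b + 1 by rewrite ltr_wpDl ?mulr_ge0.
have [Q [L [uQ QK LD]]] := KD (e / (a * b + 1)) (divr_gt0 e_gt0 ab_gt0).
exists (invmx P *m Q), (invmx P *m L *m P); split.
- by rewrite unitmx_mul unitmx_inv uP.
- by rewrite !mulmxA mulmxK // -!mulmxA QK.
move=> i j; have -> : (invmx P *m L *m P) i j - C i j =
    (invmx P *m (L - D) *m P) i j.
  by rewrite mulmxBr mulmxBl -(mulmxA _ D) -PC mulKmx // !mxE.
apply: le_lt_trans (norm_mulmx_entry _ _ _ _ (e / (a * b + 1)) i j _) _.
  by move=> k l; have := LD k l; rewrite !mxE => /ltW.
rewrite mulrAC mulrA -/a -/b ltr_pdivrMr // mulrC ltr_pM2l //.
by rewrite ltrDl.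
Qed.

(** Scaling the second block of the basis by [d] multiplies the off-diagonal
    block by [d] and leaves the diagonal blocks alone. *)
Lemma sim_limit_lblock {R : realType} n1 n2 (K1 D1 : 'M[R]_n1) X
    (K2 D2 : 'M[R]_n2) :
  sim_limit K1 D1 -> sim_limit K2 D2 ->
  sim_limit (block_mx K1 0 X K2) (block_mx D1 0 0 D2).
Proof.
move=> KD1 KD2 e e_gt0.
have [P1 [L1 [uP1 PK1 LD1]]] := KD1 e e_gt0.
have [P2 [L2 [uP2 PK2 LD2]]] := KD2 e e_gt0.
have [Y YP1] : exists Y, Y *m P1 = P2 *m X.
  by exists (P2 *m X *m invmx P1); rewrite mulmxKV.
pose a := \sum_i \sum_j `|Y i j|.
have a_ge0 : 0 <= a by do 2 (apply: sumr_ge0 => ? _).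
have a1_gt0 : 0 < a + 1 by rewrite ltr_wpDl.
pose d := e / (a + 1); have d_gt0 : 0 < d by exact: divr_gt0.
exists (block_mx P1 0 0 (d *: P2)), (block_mx L1 0 (d *: Y) L2); split.
- by rewrite block_diag_mx_unit uP1 unitmxZ // unitfE gt_eqF.
- rewrite !mulmx_block !(mul0mx, mulmx0, addr0, add0r) PK1.
  by rewrite -!scalemxAl -scalemxAr PK2 YP1.
move=> i j; rewrite !mxE; case: splitP => i' _; rewrite !mxE;
  case: splitP => j' _; rewrite ?mxE //.
- by rewrite subrr normr0.
rewrite subr0 normrM gtr0_norm // /d mulrAC ltr_pdivrMr // ltr_pM2l //.
suff : `|Y i' j'| <= a by move=> /le_lt_trans; apply; rewrite ltrDl.
apply: (@le_trans _ _ (\sum_j `|Y i' j|)).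
  by rewrite (bigD1 j') //= lerDl sumr_ge0.
by rewrite /a [leRHS](bigD1 i') //= lerDl sumr_ge0 // => k _; rewrite sumr_ge0.
Qed.

(** Let [q] be the minimal polynomial of [K] and [g] the gcd of [q] and its
    derivative. If [q] has no multiple root then [K] is diagonalizable over the
    complex numbers; otherwise [g] is a proper nonconstant divisor of [q], so
    that [g(K)] is neither zero nor invertible, and its kernel is the
    subspace. *)
Lemma diagonalizable_or_stable {R : realType} n (K : 'M[R]_n) :
  diagonalizable (complex_mx K) \/
  exists U : 'M_n, stablemx U K /\ (0 < \rank U < n)%N.
Proof.
case: n => [|n] in K *.
  by left; rewrite [complex_mx K]thinmx0; exact: diagonalizable0.
set q := mxminpoly K.
have q_monic : q \is monic by exact: mxminpoly_monic.
have q_neq0 : q != 0 by exact: monic_neq0.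
have [sep_q|nsep_q] := boolP (separable_poly q).
  left; apply/diagonalizableP.
  have [rs qE] := closed_field_poly_normal (map_poly (real_complex R) q).
  rewrite lead_coef_map (monicP q_monic) rmorph1 scale1r in qE.
  exists rs; last by rewrite -qE -mxminpoly_map.
  by rewrite -separable_prod_XsubC -qE separable_map.
right; pose g := gcdp q q^`().
have sq_gt1 : (1 < size q)%N by rewrite size_mxminpoly ltnS mxminpoly_nonconstant.
have dq_neq0 : q^`() != 0.
  by rewrite -size_poly_eq0 polyorder.size_deriv -lt0n -ltnS prednK // ltnW.
have g_lt : (size g < size q)%N.
  by apply: leq_ltn_trans (leq_gcdpr _ dq_neq0) (lt_size_deriv q_neq0).
exists (kermx (horner_mx K g)); split.
  exact: (@comm_mx_stable_kermxpoly _ _ K K g (comm_mx_refl K)).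
have : horner_mx K g != 0.
  apply/eqP => /mxminpoly_minP /(dvdp_leq _); rewrite leqNgt g_lt.
  by rewrite gcdp_eq0 negb_and q_neq0 => /(_ isT).
rewrite -mxrank_eq0 mxrank_ker subn_gt0 -lt0n => rk_gt0.
rewrite ltn_neqAle rank_leq_row andbT ltn_subrL rk_gt0 !andbT.
apply: contra nsep_q => /eqP rk_n.
have ug : horner_mx K g \in unitmx by rewrite -row_free_unit /row_free rk_n.
have [d qE] := dvdpP _ _ (dvdp_gcdl q q^`()).
(* If g(K) were invertible, the cofactor d of g in q would annihilate K. *)
have : horner_mx K d = 0.
  apply: (can_inj (mulmxK ug)); rewrite mul0mx mulmxE -rmorphM /= -/g -qE.
  exact: mx_root_minpoly.
have d_neq0 : d != 0 by apply: contraNneq q_neq0 => d0; rewrite qE d0 mul0r.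
have g_neq0 : g != 0 by rewrite gcdp_eq0 negb_and q_neq0.
move=> /mxminpoly_minP /(dvdp_leq d_neq0); rewrite -/q {1}qE size_mul //.
rewrite separable_poly.unlock /coprimep -/g.
by move: d_neq0 g_neq0; rewrite -!size_poly_gt0; lia.
Qed.

Lemma stable_block {F : fieldType} n (K U : 'M[F]_n) : stablemx U K ->
  exists n1 n2 (W : 'M_(n1 + n2, n)) K1 X K2,
    [/\ n1 = \rank U, (n1 + n2 = n)%N, row_full W
      & W *m K = block_mx K1 0 X K2 *m W].
Proof.
move=> stU; exists (\rank U), (\rank U^C)%MS.
pose W := col_mx (row_base U) (row_base U^C)%MS.
have fullW : row_full W.
  rewrite -sub1mx -addsmxE.
  by rewrite (adds_eqmx (eq_row_base _) (eq_row_base _)) sub1mx addsmx_compl_full.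
have [L /esym LE] := submxP (submx_full (row_base U^C *m K)%MS fullW).
have /submxP[K1 K1E] : (row_base U *m K <= row_base U)%MS.
  by rewrite eq_row_base (eqmxMr _ (eq_row_base U)).
exists W, K1, (lsubmx L), (rsubmx L); split=> //.
  by rewrite mxrank_compl subnKC ?rank_leq_row.
by rewrite mul_block_col mul0mx addr0 -mul_row_col hsubmxK LE -K1E mul_col_mx.
Qed.

(** Induction on the size: an invariant subspace makes [K] block triangular, and
    in the limit the off-diagonal block disappears while the characteristic
    polynomial stays. *)
Lemma sim_limit_diagonalizable {R : realType} n (K : 'M[R]_n) :
  exists D, [/\ diagonalizable (complex_mx D), char_poly K = char_poly D
    & sim_limit K D].
Proof.
have [N] := ubnP n; elim: N => // N IH in n K *; rewrite ltnS => leN.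
have [|[U [stU /andP[U_gt0 U_lt]]]] := diagonalizable_or_stable n K.
  by exists K; split=> //; exact: sim_limit_refl.
have [n1 [n2 [W [K1 [X [K2 [n1E nE fullW WK]]]]]]] := stable_block n K U stU.
subst n.
have lt1 : (n1 < N)%N by lia.
have [D1 [dD1 cD1 KD1]] := IH _ K1 lt1.
have lt2 : (n2 < N)%N by lia.
have [D2 [dD2 cD2 KD2]] := IH _ K2 lt2.
rewrite row_full_unit in fullW.
exists (block_mx D1 0 0 D2); split.
- rewrite /complex_mx map_block_mx !map_mx0.
  exact: diagonalizable_block_diag.
- by rewrite (char_poly_sim _ _ _ _ fullW WK) !char_poly_lblock cD1 cD2.
exact: sim_limit_siml fullW WK (sim_limit_lblock _ _ _ _ _ _ _ KD1 KD2).
Qed.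

(** * Spectra of positive diagonalizable matrices *)

Lemma finite_pos_lower_bound {R : realType} (T : finType) (f : T -> R) :
  (forall t, 0 < f t) -> exists2 e, 0 < e & forall t, e <= f t.
Proof.
move=> f_gt0; exists (\big[Order.min/1]_t f t); first exact: lt_bigmin.
by move=> t; exact: bigmin_le_cond.
Qed.

(** Any real matrix [K] with the allowed Jordan form is similar to real matrices
    arbitrarily close to [C], hence to a positive one. *)
Lemma universally_realizable_of_positive {R : realType} (s : seq R[i]) n
    (C : 'M[R]_n) :
    n = size s -> (forall i j, 0 < C i j) -> diagonalizable (complex_mx C) ->
  has_spectrum (complex_mx C) s -> universally_realizable s.
Proof.
move=> nE; subst n => C_gt0 dC specC J [specJ [K [jordanJ [P uP KJ]]]].
have {}KJ := elimT (simmxP uP) KJ.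
have [D [dD KD limD]] := sim_limit_diagonalizable _ K.
have KC : char_poly K = char_poly C.
  apply: (map_poly_inj (real_complex R)); rewrite !map_char_poly.
  by rewrite (char_poly_sim _ _ _ _ uP KJ) specJ -specC.
have [S uS SCD] : exists2 S, S \in unitmx & S *m C = D *m S.
  have [|S uS] := diagonalizable_char_poly_sim _ _ _ dC dD;
    last exact: sim_descent.
  by rewrite /complex_mx -!map_char_poly -KC KD.
have [e e_gt0 eC] := finite_pos_lower_bound _ (fun ij => C ij.1 ij.2)
  (fun ij => C_gt0 ij.1 ij.2).
have [Q [L [uQ QK LC]]] := sim_limit_simr _ _ _ _ _ uS SCD limD _ e_gt0.
exists L; split=> [i j|].
  have := LC i j; rewrite ltr_distl => /andP[+ _].
  by move=> /ltW; apply: le_trans; rewrite subr_ge0 (eC (i, j)).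
split=> //; have uQc : complex_mx Q \in unitmx by rewrite map_unitmx.
exists (P *m invmx (complex_mx Q)); first by rewrite unitmx_mul uP unitmx_inv.
apply/simmxP; first by rewrite unitmx_mul uP unitmx_inv.
rewrite mulmxA -KJ -!mulmxA; congr (_ *m _).
apply: (can_inj (mulKmx uQc)); rewrite mulKVmx // !mulmxA.
by rewrite /complex_mx -map_mxM QK map_mxM mulmxK.
Qed.

(** * Constant row sums and the quotient by the all-ones vector *)

(** The rows of [last_diff n], the differences of each of the first [n] basis
    row vectors with the last one, form a basis of the row vectors of sum zero.
    They are the linear forms that vanish on the all-ones vector, so the right
    action on them is that of the quotient. *)
Definition last_diff {R : pzRingType} n : 'M[R]_(n, n + 1) :=
  row_mx 1%:M (- const_mx 1).

Lemma row_free_last_diff {F : fieldType} n : row_free (last_diff n : 'M[F]__).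
Proof.
by apply/row_freeP; exists (col_mx 1%:M 0); rewrite mul_row_col mulmx1 mulmx0 addr0.
Qed.

Lemma last_diff_const {R : pzRingType} n p (a : R) :
  last_diff n *m const_mx a = 0 :> 'M_(n, p).
Proof.
rewrite -[const_mx a]vsubmxK mul_row_col mul1mx; apply/matrixP => i j.
by rewrite !mxE big_ord1 !mxE mulN1r subrr.
Qed.

Lemma mul_last_diff {R : pzRingType} n p (X : 'M[R]_(p, n)) :
  X *m last_diff n = row_mx X (- (X *m const_mx 1)).
Proof. by rewrite mul_mx_row mulmx1 mulmxN. Qed.

(** The matrix of the action on the basis [last_diff n]; it represents [A] on the
    quotient by the all-ones vector when the row sums of [A] are constant, see
    [last_diff_mul]. *)
Definition quotient_mx {R : pzRingType} {n} (A : 'M[R]_(n + 1)) : 'M_n :=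
  last_diff n *m lsubmx A.

(** The last column is determined by the others and the row sum. *)
Lemma const_row_sumE {R : realType} p n (A : 'M[R]_(p, n + 1)) a :
  (forall i, \sum_j A i j = a) ->
  A = lsubmx A *m last_diff n + row_mx 0 (const_mx a).
Proof.
move=> sumA; rewrite mul_last_diff add_row_mx addr0 -{1}[A]hsubmxK.
congr row_mx; apply/matrixP => i j; rewrite !mxE -(sumA i) big_split_ord /=.
rewrite big_ord1 [j]ord1 addrA -[LHS]add0r; congr (_ + _).
apply/esym/eqP; rewrite addrC subr_eq0; apply/eqP/eq_bigr => k _.
by rewrite !mxE mulr1.
Qed.

Lemma last_diff_mul {R : realType} n (A : 'M[R]_(n + 1)) a :
  const_row_sum A a -> last_diff n *m A = quotient_mx A *m last_diff n.
Proof.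
move=> /const_row_sumE {1}->; rewrite mulmxDr (mul_mx_row _ 0) mulmx0.
by rewrite last_diff_const row_mx0 addr0 mulmxA.
Qed.

(** Completing [last_diff n] to a basis by the last coordinate form makes [A]
    block triangular, with the row sum as its last diagonal entry. *)
Lemma char_poly_quotient {R : realType} n (A : 'M[R]_(n + 1)) a :
  const_row_sum A a -> char_poly A = char_poly (quotient_mx A) * ('X - a%:P).
Proof.
move=> sumA; pose W : 'M[R]_(n + 1) := block_mx 1%:M (- const_mx 1) 0 1%:M.
have uW : W \in unitmx by rewrite unitmxE det_ublock !det1 mulr1 unitr1.
have -> : 'X - a%:P = char_poly (a%:M : 'M_1).
  by rewrite /char_poly /char_poly_mx map_scalar_mx -raddfB det_scalar1.
rewrite -(char_poly_lblock _ _ _ (dlsubmx A)); apply: (char_poly_sim _ W) => //.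
rewrite /W block_mxEv mul_col_mx (last_diff_mul _ _ _ sumA).
rewrite mul_block_col mul0mx addr0; congr col_mx.
rewrite -[A in LHS]vsubmxK mul_row_col mul0mx mul1mx add0r.
rewrite (mul_mx_row a%:M) mulmx0 mulmx1.
have -> : a%:M = const_mx a :> 'M_1 by apply/matrixP => i j; rewrite !mxE !ord1.
apply: const_row_sumE => i; rewrite -(sumA (rshift n i)).
by apply: eq_bigr => j _; rewrite mxE.
Qed.

Lemma diagonalizable_quotient {R : realType} n (A : 'M[R]_(n + 1)) a :
  const_row_sum A a -> diagonalizable (complex_mx A) ->
  diagonalizable (complex_mx (quotient_mx A)).
Proof.
move=> /last_diff_mul VA; apply:
  (diagonalizable_restrict _ _ (map_mx (real_complex R) (last_diff n))).
  by rewrite /complex_mx row_free_map row_free_last_diff.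
by rewrite /complex_mx -!map_mxM VA.
Qed.

Lemma diagonalizable_of_quotient {R : realType} n (A : 'M[R]_(n + 1)) a :
  const_row_sum A a -> ~~ root (char_poly (complex_mx (quotient_mx A))) a%:C ->
  diagonalizable (complex_mx (quotient_mx A)) -> diagonalizable (complex_mx A).
Proof.
move=> sumA; apply:
  (diagonalizable_extend _ _ (map_mx (real_complex R) (last_diff n))).
  by rewrite /complex_mx -!map_mxM (last_diff_mul _ _ _ sumA).
rewrite /complex_mx -map_scalar_mx -map_mxB map_submx.
have /const_row_sumE -> : forall i, \sum_j (A - a%:M) i j = 0.
  move=> i; under eq_bigr => j _ do rewrite !mxE.
  rewrite sumrB sumA (bigD1 i) //= eqxx big1 ?addr0 ?subrr // => j.
  by rewrite eq_sym => /negPf ->.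
by rewrite row_mx0 addr0 submxMl.
Qed.

(** The first columns of a matrix with row sums [a] may be increased by a
    constant [e], at the expense of the last column, without changing the
    quotient. The last column is positive to begin with, so both parts are
    positive for small [e]. *)
Lemma positive_of_quotient {R : realType} n (X : 'M[R]_(n + 1, n)) a :
    (forall i j, 0 <= X i j) -> (forall i, \sum_j X i j < a) ->
  exists C : 'M_(n + 1), [/\ forall i j, 0 < C i j, const_row_sum C a
    & quotient_mx C = last_diff n *m X].
Proof.
move=> X_ge0 X_lt; pose f i := (a - \sum_j X i j) / n.+1%:R.
have [e e_gt0 ef] : exists2 e, 0 < e & forall i, e <= f i.
  by apply: finite_pos_lower_bound => i; rewrite divr_gt0 ?subr_gt0 ?ltr0n.
pose Y := X + const_mx e.
(* The division by n + 1 rather than n in f makes the last column positive. *)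
exists (row_mx Y (const_mx a - Y *m const_mx 1)); split=> [i j|i|].
- rewrite mxE; case: splitP => k _; rewrite !mxE.
    by rewrite ltr_wpDl.
  rewrite subr_gt0; under eq_bigr => l _ do rewrite !mxE mulr1.
  rewrite big_split /= sumr_const card_ord addrC -ltrBrDr.
  have := ef i; rewrite ler_pdivlMr ?ltr0n // mulr_natr mulrSr.
  by apply: lt_le_trans; rewrite ltrDl.
- rewrite big_split_ord /= big_ord1 row_mxEr !mxE.
  under eq_bigr => l _ do rewrite row_mxEl.
  under [X in _ + (_ - X)]eq_bigr => l _ do rewrite [const_mx 1 _ _]mxE mulr1.
  by rewrite addrC subrK.
by rewrite /quotient_mx row_mxKl mulmxDr last_diff_const addr0.
Qed.

(** * Gluing two matrices along their last index *)

(** All columns but the last of the glued matrix, where [X] and [Y] are all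
    columns but the last of the two matrices. The last indices are identified,
    and the off-diagonal blocks repeat the row of the last index, so that they
    cancel in the quotient. *)
Definition glue_mx {R : pzRingType} {n m} (X : 'M[R]_(n + 1, n))
    (Y : 'M[R]_(m + 1, m)) : 'M[R]_(n + m + 1, n + m) :=
  col_mx (block_mx (usubmx X) (const_mx 1 *m dsubmx Y)
                   (const_mx 1 *m dsubmx X) (usubmx Y))
         (row_mx (dsubmx X) (dsubmx Y)).

Lemma last_diff_glue {R : pzRingType} n m (X : 'M[R]_(n + 1, n))
    (Y : 'M[R]_(m + 1, m)) :
  last_diff (n + m) *m glue_mx X Y =
    block_mx (last_diff n *m X) 0 0 (last_diff m *m Y).
Proof.
rewrite -{2}[X]vsubmxK -{2}[Y]vsubmxK /last_diff !mul_row_col !mul1mx.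
rewrite -(@col_mx_const _ n m 1) mulNmx mul_col_row opp_block_mx add_block_mx.
by rewrite !subrr !mulNmx.
Qed.

(** Each row of the glued matrix juxtaposes a row of [X] and a row of [Y]; hence
    nonnegativity and the bounds on the row sums pass to it. *)
Lemma row_glue {R : pzRingType} n m (X : 'M[R]_(n + 1, n))
    (Y : 'M[R]_(m + 1, m)) i :
  exists k l, row i (glue_mx X Y) = row_mx (row k X) (row l Y).
Proof.
have const1_mul p q (z : 'rV[R]_q) (k : 'I_p) : row k (const_mx 1 *m z) = z.
  by apply/rowP => j; rewrite !mxE big_ord1 !mxE mul1r.
have dsub_row p (Z : 'M[R]_(p + 1, p)) : dsubmx Z = row (rshift p 0) Z.
  by apply/matrixP => k l; rewrite !mxE ord1.
rewrite /glue_mx -(splitK i); case: (split i) => [i1|i1] /=.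
  rewrite rowKu -(splitK i1); case: (split i1) => [k|l] /=.
    exists (lshift 1 k), (rshift m 0).
    by rewrite block_mxEv rowKu row_row_mx const1_mul row_usubmx dsub_row.
  exists (rshift n 0), (lshift 1 l).
  by rewrite block_mxEv rowKd row_row_mx const1_mul row_usubmx dsub_row.
exists (rshift n 0), (rshift m 0).
by rewrite rowKd row_row_mx !dsub_row [i1]ord1 !row_id.
Qed.

Lemma glue_universally_realizable {R : realType} n m a (A : 'M[R]_(n + 1))
    (s : seq R[i]) b (B : 'M[R]_(m + 1)) (t : seq R[i]) :
    size s = n -> size t = m ->
    (a + b)%:C \notin s ++ t ->
    has_spectrum (complex_mx A) (a%:C :: s) -> diagonalizable (complex_mx A) ->
    nonneg_mx A -> const_row_sum A a -> (forall i, 0 < A i (rshift n 0)) ->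
    has_spectrum (complex_mx B) (b%:C :: t) -> diagonalizable (complex_mx B) ->
    nonneg_mx B -> const_row_sum B b -> (forall i, 0 < B i (rshift m 0)) ->
  universally_realizable ((a + b)%:C :: s ++ t).
Proof.
move=> sn tm ab_notin specA dA A_ge0 sumA A_gt0 specB dB B_ge0 sumB B_gt0.
have lsub_lt p (M : 'M[R]_(p + 1)) c : const_row_sum M c ->
    (forall i, 0 < M i (rshift p 0)) -> forall i, \sum_j lsubmx M i j < c.
  move=> sumM M_gt0 i; rewrite -(sumM i) big_split_ord /= big_ord1.
  by under eq_bigr => j _ do rewrite mxE; rewrite ltrDl.
have quotient_spec p (M : 'M[R]_(p + 1)) c r : const_row_sum M c ->
    has_spectrum (complex_mx M) (c%:C :: r) ->
    has_spectrum (complex_mx (quotient_mx M)) r.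
  move=> sumM; rewrite /has_spectrum /complex_mx -!map_char_poly.
  rewrite (char_poly_quotient _ _ _ sumM) rmorphM rmorphB /= map_polyX.
  rewrite map_polyC big_cons mulrC; apply: mulfI.
  by rewrite polyXsubC_eq0.
pose X := glue_mx (lsubmx A) (lsubmx B).
have [i j|i|C [C_gt0 sumC CX]] := positive_of_quotient _ X (a + b).
- have [k [l /rowP/(_ j)]] := row_glue _ _ (lsubmx A) (lsubmx B) i.
  by rewrite mxE => ->; rewrite mxE; case: splitP => ? _; rewrite !mxE.
- have [k [l /rowP rowX]] := row_glue _ _ (lsubmx A) (lsubmx B) i.
  have XE j : X i j = row_mx (row k (lsubmx A)) (row l (lsubmx B)) 0 j.
    by rewrite -rowX [RHS]mxE.
  rewrite (eq_bigr _ (fun j _ => XE j)) big_split_ord /=; apply: ltrD.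
    by under eq_bigr => j _ do rewrite row_mxEl mxE; exact: lsub_lt.
  by under eq_bigr => j _ do rewrite row_mxEr mxE; exact: lsub_lt.
have {}CX : quotient_mx C = block_mx (quotient_mx A) 0 0 (quotient_mx B).
  by rewrite CX last_diff_glue.
have char_quotC : char_poly (complex_mx (quotient_mx C)) =
    \prod_(z <- s ++ t) ('X - z%:P).
  rewrite CX /complex_mx map_block_mx !map_mx0 char_poly_lblock big_cat /=.
  congr (_ * _); first exact: quotient_spec sumA specA.
  exact: quotient_spec sumB specB.
apply: (universally_realizable_of_positive _ _ C) => //.
- by rewrite /= size_cat sn tm addn1.
- apply: (diagonalizable_of_quotient _ _ _ sumC).
    by rewrite char_quotC root_prod_XsubC.
  rewrite CX /complex_mx map_block_mx !map_mx0; apply: diagonalizable_block_diag.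
    exact: diagonalizable_quotient sumA dA.
  exact: diagonalizable_quotient sumB dB.
rewrite /has_spectrum big_cons -char_quotC mulrC.
rewrite /complex_mx -!map_char_poly (char_poly_quotient _ _ _ sumC).
by rewrite rmorphM rmorphB /= map_polyX map_polyC.
Qed.



Theorem theorem5p1 (R : realType) (n m : nat)
    (lambda1 : R) (lambda : n.-tuple R[i]) (A : 'M[R]_n.+1)
    (mu1 : R) (mu : m.-tuple R[i]) (B : 'M[R]_m.+1)
    (lambda1_dom : forall z, z \in lambda -> `|z| < lambda1%:C)
    (A_spec : has_spectrum (complex_mx A) (lambda1%:C :: lambda))
    (A_diag : diagonalizable (complex_mx A))
    (A_ge0 : nonneg_mx A)
    (A_rows : const_row_sum A lambda1)
    (A_last : forall i, 0 < A i ord_max)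
    (mu1_dom : forall z, z \in mu -> `|z| < mu1%:C)
    (B_spec : has_spectrum (complex_mx B) (mu1%:C :: mu))
    (B_diag : diagonalizable (complex_mx B))
    (B_ge0 : nonneg_mx B)
    (B_rows : const_row_sum B mu1)
    (B_last : forall i, 0 < B i ord_max) :
  universally_realizable ((lambda1 + mu1)%:C :: lambda ++ mu).
Proof.
have row_sum_gt0 p (M : 'M[R]_p.+1) c : nonneg_mx M ->
    (forall i, 0 < M i ord_max) -> const_row_sum M c -> 0 < c.
  move=> M_ge0 M_last sumM; rewrite -(sumM ord_max) (bigD1 ord_max) //=.
  by rewrite ltr_wpDr // sumr_ge0 // => j _; exact: M_ge0.
have lambda1_gt0 := row_sum_gt0 _ _ _ A_ge0 A_last A_rows.
have mu1_gt0 := row_sum_gt0 _ _ _ B_ge0 B_last B_rows.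
have notin : (lambda1 + mu1)%:C \notin (lambda ++ mu).
  have norm_sum : `|(lambda1 + mu1)%:C| = (lambda1 + mu1)%:C.
    by rewrite ger0_norm // lecR ltW // addr_gt0.
  apply/negP; rewrite mem_cat => /orP[/lambda1_dom|/mu1_dom];
    rewrite norm_sum ltcR.
    by rewrite ltNge lerDl ltW.
  by rewrite ltNge lerDr ltW.
(* Naming the last column by its value allows n.+1 to be replaced by n + 1. *)
have {}A_last (i j : 'I_n.+1) : j = n :> nat -> 0 < A i j.
  by move=> jn; have -> : j = ord_max by exact: val_inj.
have {}B_last (i j : 'I_m.+1) : j = m :> nat -> 0 < B i j.
  by move=> jm; have -> : j = ord_max by exact: val_inj.
clear row_sum_gt0; move: A A_spec A_diag A_ge0 A_rows A_last.
move: B B_spec B_diag B_ge0 B_rows B_last; rewrite -[n.+1]addn1 -[m.+1]addn1.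
move=> B B_spec B_diag B_ge0 B_rows B_last A A_spec A_diag A_ge0 A_rows A_last.
apply: (glue_universally_realizable _ _ _ A _ _ B) => //; rewrite ?size_tuple //.
  by move=> i; apply: A_last; rewrite /= addn0.
by move=> i; apply: B_last; rewrite /= addn0.
Qed.
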